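(* Let $N\ge4$ be a non-prime integer, $N=mn$ with integers $m,n\ge2$, let $\omega=e^{2\pi i/N}$, let $p\in\mathbb{Z}\setminus\{0,1,-1\}$ with $p/N,(p+1)/N,(p-1)/N\notin\mathbb{Z}$, let $a,b\in\mathbb{R}$ with $ab\ne0$, and let $q_k(t)$, $k=0,\dots,N-1$, be the $N$-body choreographic motion on the $p$-limaçon curve $q(t)=a(\cos t,\sin t)+b(\cos pt,\sin pt)$. For $\ell\in\{0,1,\dots,n-1\}$ set $$g_m(\ell)=\sum_{k=0}^{m-1}q_{\ell+kn},\quad I_m(\ell)=\sum_{k=0}^{m-1}|q_{\ell+kn}|^2,\quad c_m(\ell)=\sum_{k=0}^{m-1}q_{\ell+kn}\times\dot q_{\ell+kn},$$ $$K_m(\ell)=\frac12\sum_{k=0}^{m-1}|\dot q_{\ell+kn}|^2,\quad \tilde I_m(\ell)=\sum_{0\le i<j\le m-1}|q_{\ell+in}-q_{\ell+jn}|^2.$$ Then, for all $t$ and all $\ell\in\{0,\dots,n-1\}$: (1) If $\omega^{pn}\ne1$, then $g_m(\ell)=0$. If $\omega^{pn}=1$, then, identifying $\mathbb{R}^2$ with $\mathbb{C}$, $g_m(\ell)=bm\,e^{ipt}\omega^{\ell p}$, and $|g_m(\ell)|^2=(bm)^2$. (2) If $\omega^{(p-1)n}\neq1$, then $I_m(\ell)=m(a^2+b^2)$, $c_m(\ell)=m(a^2+pb^2)$ and $K_m(\ell)=\frac12 m(a^2+p^2b^2)$. (3) If $\omega^{(p-1)n}\neq1$, then $\tilde I_m(\ell)=mI_m(\ell)-|g_m(\ell)|^2$,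 which equals $m^2(a^2+b^2)$ if $\omega^{np}\ne1$ and $m^2a^2$ if $\omega^{np}=1$.
   Context: The $N$-body choreographic motion is $q_k(t)=q\left(t+\frac{2\pi k}{N}\right)\in\mathbb{R}^2$, $k=0,1,\dots,N-1$. A point $(x,y)\in\mathbb{R}^2$ is identified with $x+iy\in\mathbb{C}$. For $u=(u_1,u_2),v=(v_1,v_2)\in\mathbb{R}^2$, $u\times v=u_1v_2-u_2v_1$. A dot denotes the derivative with respect to $t$. *)

(* Defs.v *)
From HB Require Import structures.
From mathcomp Require Import all_boot all_order all_algebra.
From mathcomp Require Import all_classical all_reals all_analysis.
From mathcomp Require Export complex.
Set Implicit Arguments.
Unset Strict Implicit.
Unset Printing Implicit Defensive.
Import Order.TTheory GRing.Theory Num.Theory.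
Import numFieldNormedType.Exports.
Local Open Scope ring_scope.
Local Open Scope complex_scope.

Section Plane.
Variable R : realType.

(* The canonical norm of MathComp-Analysis on [R * R] is the max norm, hence
   an explicit Euclidean norm. *)
Definition enorm (u : R * R) : R := Num.sqrt (u.1 ^+ 2 + u.2 ^+ 2).

Definition cross (u v : R * R) : R := u.1 * v.2 - u.2 * v.1.

Definition plane_to_C (u : R * R) : R[i] := u.1 +i* u.2.

Definition cexp (z : R[i]) : R[i] :=
  (expR (complex.Re z))%:C * (cos (complex.Im z) +i* sin (complex.Im z)).

Definition limacon (a b : R) (p : int) (t : R) : R * R :=
  a *: (cos t, sin t) + b *: (cos (p%:~R * t), sin (p%:~R * t)).

Definition choreography (N : nat) (q : R -> R * R) (k : nat) (t : R) : R * R :=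
  q (t + 2 * pi * k%:R / N%:R).

End Plane.

(* [q] gives the motions of all the bodies; only those with index [l + k n],
   [0 <= k < m], enter the sums. *)
Section SubPolygon.
Variables (R : realType) (m n : nat) (q : nat -> R -> R * R) (l : nat) (t : R).

Definition g_sub : R * R := \sum_(k < m) q (l + k * n)%N t.

Definition I_sub : R := \sum_(k < m) enorm (q (l + k * n)%N t) ^+ 2.

Definition c_sub : R :=
  \sum_(k < m) cross (q (l + k * n)%N t) (derive1 (q (l + k * n)%N) t).

Definition K_sub : R :=
  2^-1 * \sum_(k < m) enorm (derive1 (q (l + k * n)%N) t) ^+ 2.

Definition Itilde_sub : R :=
  \sum_(i < m) \sum_(j < m | (i < j)%N)
    enorm (q (l + i * n)%N t - q (l + j * n)%N t) ^+ 2.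

End SubPolygon.

(* Main.v *)
Require Import Defs.
From HB Require Import structures.
From mathcomp Require Import all_boot all_order all_algebra.
From mathcomp Require Import all_classical all_reals all_analysis.
From mathcomp Require Import complex.
From mathcomp Require Import ring.
Set Implicit Arguments.
Unset Strict Implicit.
Unset Printing Implicit Defensive.
Import Order.TTheory GRing.Theory Num.Theory.
Import numFieldNormedType.Exports.
Local Open Scope ring_scope.
Local Open Scope complex_scope.

(** Write cis x for e^(ix) and put alpha = 2 pi / N.  The bodies l + k n with
    0 <= k < m sit on the limaçon at the parameters theta + k delta, where
    theta = t + l alpha and delta = n alpha = 2 pi / m.  Everything comes down
    to sums of cis (x + k j delta) over k with j an integer, that is, to
    geometric sums whose ratio cis (j delta) = omega ^ (j n) is an m-th root of
    unity.  Such a sum is m cis x if the ratio is 1 ([sum_cis_const]) and 0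
    otherwise ([sum_cis_eq0]).

    In the complex plane q = a cis s + b cis (p s), so the centre g involves
    the harmonics j = 1 and j = p.  The first always cancels, since
    cis delta != 1 for m >= 2; the second one cancels unless omega ^ (p n) = 1,
    and then it contributes m b cis (p theta).

    The squared length of q, its cross product with the velocity and the
    squared speed are invariant under rotations, hence depend on s only
    through the angle (p - 1) s between the two rotating vectors: each one is a
    constant plus a multiple of cos ((p - 1) s).  This is the harmonic
    j = p - 1, which cancels when omega ^ ((p - 1) n) != 1, so that m times the
    constant remains ([sum_relative_harmonic]).

    The sum of the squared mutual distances reduces to these by Lagrange's
    identity ([sum_sqr_enorm_dist]), which holds for any m points. *)

(** * Geometric sums on the unit circle *)

Section UnitCircle.
Variable R : realType.
Implicit Types (x y d : R) (m : nat).

Definition cis x : R[i] := cos x +i* sin x.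

Lemma cis0 : cis 0 = 1.
Proof. by rewrite /cis cos0 sin0. Qed.

Lemma cisD x y : cis (x + y) = cis x * cis y.
Proof.
by apply/eqP; rewrite eq_complex /= cosD sinD (addrC (sin x * _)) !eqxx.
Qed.

Lemma cisN x : cis (- x) = (cis x)^-1.
Proof.
have E : cis x * cis (- x) = 1 by rewrite -cisD subrr cis0.
have U : cis x != 0.
  by apply: contra_eq_neq E => ->; rewrite mul0r eq_sym oner_eq0.
by apply: (mulfI U); rewrite E divff.
Qed.

Lemma cisMn x m : cis (m%:R * x) = cis x ^+ m.
Proof.
elim: m => [|m IHm]; first by rewrite mul0r cis0 expr0.
by rewrite mulrSr mulrDl mul1r cisD IHm exprSr.
Qed.

Lemma cisMz x (k : int) : cis (k%:~R * x) = cis x ^ k.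
Proof.
by case: k => k; [exact: cisMn | rewrite NegzE mulrNz mulNr cisN cisMn].
Qed.

Lemma cexp_imaginary x : cexp (x%:C * 'i) = cis x.
Proof.
by rewrite /cexp -complexiE ReiNIm ImiRe /= oppr0 expR0 rmorph1 mul1r.
Qed.

Lemma cis2pi : cis (2 * pi) = 1.
Proof. by rewrite /cis mulr_natl cos2pi sin2pi. Qed.

(** The cosine is strictly decreasing from 0 to [pi], hence below 1 at [x]. *)
Lemma cis_neq1 x : 0 < x -> x <= pi -> cis x != 1.
Proof.
move=> x0 xpi; rewrite eq_complex /= negb_and; apply/orP; left.
rewrite -cos0 lt_eqF // ltr_cos ?in_itv //= ?lexx ?pi_ge0 //.
by rewrite (ltW x0).
Qed.

Lemma sum_cis_const m x d :
  cis d = 1 -> \sum_(k < m) cis (x + k%:R * d) = m%:R * cis x.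
Proof.
move=> d1; rewrite (eq_bigr (fun=> cis x)).
  by rewrite sumr_const card_ord mulr_natl.
by move=> k _; rewrite cisD cisMn d1 expr1n mulr1.
Qed.

(** Multiplied by [cis d - 1], the sum telescopes to a multiple of
    [cis d ^+ m - 1]. *)
Lemma sum_cis_eq0 m x d : cis d != 1 -> cis d ^+ m = 1 ->
  \sum_(k < m) cis (x + k%:R * d) = 0.
Proof.
move=> d1 dm.
rewrite (eq_bigr (fun k : 'I_m => cis x * cis d ^+ k)); last first.
  by move=> k _; rewrite cisD cisMn.
rewrite -big_distrr /=; apply/eqP; rewrite mulf_eq0; apply/orP; right.
have := subrX1 (cis d) m; rewrite dm subrr => /esym/eqP.
by rewrite mulf_eq0 subr_eq0 (negbTE d1).
Qed.

Lemma Re_sum (I : Type) (r : seq I) (F : I -> R[i]) :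
  complex.Re (\sum_(i <- r) F i) = \sum_(i <- r) complex.Re (F i).
Proof. by apply: (big_morph (@complex.Re R)) => // -[? ?] []. Qed.

Lemma sum_cos_eq0 m x d : cis d != 1 -> cis d ^+ m = 1 ->
  \sum_(k < m) cos (x + k%:R * d) = 0.
Proof.
move=> d1 dm.
by rewrite -[RHS]/(complex.Re 0) -(sum_cis_eq0 x d1 dm) Re_sum.
Qed.

End UnitCircle.

(** * The Euclidean plane *)

Section PlaneLemmas.
Variable R : realType.

Lemma sqr_enorm (u : R * R) : enorm u ^+ 2 = u.1 ^+ 2 + u.2 ^+ 2.
Proof. by rewrite sqr_sqrtr // addr_ge0 ?sqr_ge0. Qed.

Lemma plane_to_C_inj : injective (@plane_to_C R).
Proof. by move=> [? ?] [? ?] [-> ->]. Qed.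

Lemma plane_to_C_sum (I : Type) (r : seq I) (F : I -> R * R) :
  plane_to_C (\sum_(i <- r) F i) = \sum_(i <- r) plane_to_C (F i).
Proof. exact: (big_morph (@plane_to_C R)). Qed.

(** Lagrange's identity.  In the induction, a new number [u m] adds the sum of
    its squared differences with the previous ones. *)
Lemma sum_sqr_dist m (u : nat -> R) :
  \sum_(i < m) \sum_(j < m | (i < j)%N) (u i - u j) ^+ 2 =
  m%:R * (\sum_(i < m) u i ^+ 2) - (\sum_(i < m) u i) ^+ 2.
Proof.
elim: m => [|m IHm]; first by rewrite !big_ord0 mul0r expr0n subr0.
have -> : \sum_(i < m.+1) \sum_(j < m.+1 | (i < j)%N) (u i - u j) ^+ 2 =
    \sum_(i < m) \sum_(j < m | (i < j)%N) (u i - u j) ^+ 2 +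
    \sum_(i < m) (u i - u m) ^+ 2.
  rewrite big_ord_recr /= [X in _ + X]big1 ?addr0; last first.
    by move=> j; rewrite ltnNge -ltnS ltn_ord.
  rewrite -big_split /=; apply: eq_bigr => i _.
  by rewrite big_mkcond big_ord_recr /= ltn_ord -big_mkcond.
have -> : \sum_(i < m) (u i - u m) ^+ 2 =
    \sum_(i < m) u i ^+ 2 - 2 * u m * (\sum_(i < m) u i) + m%:R * u m ^+ 2.
  have -> : m%:R * u m ^+ 2 = \sum_(i < m) u m ^+ 2.
    by rewrite sumr_const card_ord mulr_natl.
  rewrite mulr_sumr -sumrB.
  by rewrite -big_split; apply: eq_bigr => i _ /=; ring.
rewrite IHm !big_ord_recr /= -natr1; ring.
Qed.

(** Both sides are sums over the two coordinates. *)
Lemma sum_sqr_enorm_dist m (u : nat -> R * R) :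
  \sum_(i < m) \sum_(j < m | (i < j)%N) enorm (u i - u j) ^+ 2 =
  m%:R * (\sum_(i < m) enorm (u i) ^+ 2) - enorm (\sum_(i < m) u i) ^+ 2.
Proof.
have E i j : enorm (u i - u j) ^+ 2 =
    ((u i).1 - (u j).1) ^+ 2 + ((u i).2 - (u j).2) ^+ 2.
  by rewrite sqr_enorm.
under eq_bigr do under eq_bigr do rewrite E.
under eq_bigr do rewrite big_split.
rewrite big_split /= (sum_sqr_dist m (fun i => (u i).1)).
rewrite (sum_sqr_dist m (fun i => (u i).2)).
rewrite (eq_bigr _ (fun (i : 'I_m) _ => sqr_enorm (u i))) big_split /= sqr_enorm.
rewrite (big_morph (fun v : R * R => v.1) (id1 := 0) (op1 := +%R)) //.
rewrite (big_morph (fun v : R * R => v.2) (id1 := 0) (op1 := +%R)) //.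
ring.
Qed.

Lemma derive1_pair (f g : R -> R) (x df dg : R) :
  is_derive x 1 f df -> is_derive x 1 g dg ->
  derive1 (fun y => (f y, g y)) x = (df, dg).
Proof.
move=> [df1 <-] [dg1 <-].
have fx : differentiable f x by apply/derivable1_diffP.
have gx : differentiable g x by apply/derivable1_diffP.
rewrite derive1E'; last exact: differentiable_pair.
by rewrite diff_pair // -!deriveE.
Qed.

End PlaneLemmas.

(** * Motion along one limaçon *)

Section Limacon.
Variables (R : realType) (a b : R) (p : int).
Implicit Types (s x c : R).

Definition limacon_velocity s : R * R :=
  a *: (- sin s, cos s) + (p%:~R * b) *: (- sin (p%:~R * s), cos (p%:~R * s)).

(** With [f] the cosine or the sine, this function is a coordinate of the
    limaçon. *)
Lemma is_derive_two_harmonics (f df : R -> R) c x :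
  (forall z : R, is_derive z 1 f (df z)) ->
  is_derive x 1 (fun y : R => a * f (y + c) + b * f (p%:~R * (y + c)))
    (a * df (x + c) + p%:~R * b * df (p%:~R * (x + c))).
Proof.
move=> fP.
have dsh : is_derive x 1 (fun y : R => y + c) 1.
  by apply: is_derive_eq; rewrite addr0.
have dpsh : is_derive x 1 (fun y : R => p%:~R * (y + c)) p%:~R.
  by apply: is_derive_eq; rewrite /GRing.scale /= mulr1.
have d1 : is_derive x 1 (fun y : R => f (y + c)) (df (x + c) * 1).
  exact: (@is_derive1_comp R f (fun y => y + c)).
have dp : is_derive x 1 (fun y : R => f (p%:~R * (y + c)))
    (df (p%:~R * (x + c)) * p%:~R).
  exact: (@is_derive1_comp R f (fun y => p%:~R * (y + c))).
by apply: is_derive_eq; rewrite /GRing.scale /=; ring.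
Qed.

Lemma derive1_limacon_shift c x :
  derive1 (fun y => limacon a b p (y + c)) x = limacon_velocity (x + c).
Proof.
exact: (derive1_pair (is_derive_two_harmonics c x (@is_derive_cos R))
                     (is_derive_two_harmonics c x (@is_derive_sin R))).
Qed.

Lemma plane_to_C_limacon s :
  plane_to_C (limacon a b p s) = a%:C * cis s + b%:C * cis (p%:~R * s).
Proof.
by apply/eqP; rewrite eq_complex /= !mul0r !subr0 !addr0 !eqxx.
Qed.

Lemma cos_harmonic s : cos ((p - 1)%:~R * s) =
  cos (p%:~R * s) * cos s + sin (p%:~R * s) * sin s.
Proof. by rewrite intrB mulrBl mul1r cosB. Qed.

(** This identity and the two that follow expand a scalar or cross product of
    two sums of rotating vectors: the diagonal terms are constant because the squares of
    cosine and sine add up to 1, and the mixed ones give the cosine of the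
    angle between the vectors. *)
Lemma sqr_enorm_limacon s : enorm (limacon a b p s) ^+ 2 =
  a ^+ 2 + b ^+ 2 + 2 * a * b * cos ((p - 1)%:~R * s).
Proof.
rewrite sqr_enorm /= cos_harmonic /GRing.scale /=.
transitivity (a ^+ 2 * (cos s ^+ 2 + sin s ^+ 2) + b ^+ 2 *
   (cos (p%:~R * s) ^+ 2 + sin (p%:~R * s) ^+ 2) +
  2 * a * b * (cos (p%:~R * s) * cos s + sin (p%:~R * s) * sin s)).
  ring.
by rewrite !cos2Dsin2 !mulr1.
Qed.

Lemma sqr_enorm_limacon_velocity s : enorm (limacon_velocity s) ^+ 2 =
  a ^+ 2 + p%:~R ^+ 2 * b ^+ 2 +
  2 * p%:~R * a * b * cos ((p - 1)%:~R * s).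
Proof.
rewrite sqr_enorm /= cos_harmonic /GRing.scale /=.
transitivity (a ^+ 2 * (cos s ^+ 2 + sin s ^+ 2) + p%:~R ^+ 2 * b ^+ 2 *
   (cos (p%:~R * s) ^+ 2 + sin (p%:~R * s) ^+ 2) +
  2 * p%:~R * a * b * (cos (p%:~R * s) * cos s + sin (p%:~R * s) * sin s)).
  ring.
by rewrite !cos2Dsin2 !mulr1.
Qed.

Lemma cross_limacon_velocity s :
  cross (limacon a b p s) (limacon_velocity s) =
  a ^+ 2 + p%:~R * b ^+ 2 +
  (p%:~R + 1) * a * b * cos ((p - 1)%:~R * s).
Proof.
rewrite /cross /= cos_harmonic /GRing.scale /=.
transitivity (a ^+ 2 * (cos s ^+ 2 + sin s ^+ 2) + p%:~R * b ^+ 2 *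
   (cos (p%:~R * s) ^+ 2 + sin (p%:~R * s) ^+ 2) +
  (p%:~R + 1) * a * b * (cos (p%:~R * s) * cos s + sin (p%:~R * s) * sin s)).
  ring.
by rewrite !cos2Dsin2 !mulr1.
Qed.

End Limacon.

(** * Every n-th body *)

Section RegularSubfamily.
Variables (R : realType) (m n : nat) (a b : R) (p : int).
Hypotheses (m_gt1 : (1 < m)%N) (n_gt0 : (0 < n)%N).
Variables (t : R) (l : nat).

Let q := choreography (m * n) (limacon a b p).
Let alpha : R := 2 * pi / (m * n)%:R.
Let theta := t + l%:R * alpha.
Let delta := n%:R * alpha.

Lemma omegaE : cexp (2 * (pi : R)%:C * 'i / (m * n)%:R) = cis alpha.
Proof.
rewrite -cexp_imaginary; congr cexp.
rewrite /alpha mulrAC -[_%:C in RHS]/(real_complex R _).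
by rewrite !(rmorphM (real_complex R)) fmorphV !rmorph_nat.
Qed.

Lemma deltaE : m%:R * delta = 2 * pi.
Proof.
rewrite /delta /alpha natrM; field.
by rewrite !pnatr_eq0 -!lt0n n_gt0 ltnW.
Qed.

Lemma omega_exp (j : int) : cis (j%:~R * delta) = cis alpha ^ (j * n%:Z).
Proof. by rewrite /delta mulrA -cisMz intrM. Qed.

(** [m] steps of length [delta] make a full turn. *)
Lemma cis_int_delta_expm (j : int) : cis (j%:~R * delta) ^+ m = 1.
Proof. by rewrite -cisMn mulrCA deltaE cisMz cis2pi exp1rz. Qed.

(** The step [delta] is [2 * pi / m], which is positive and at most [pi] as soon
    as [m >= 2]. *)
Lemma cis_delta_neq1 : cis delta != 1.
Proof.
have m0 : (0 : R) < m%:R by rewrite ltr0n ltnW.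
have -> : delta = 2 * pi / m%:R by rewrite -deltaE [RHS]mulrC mulKf ?gt_eqF.
apply: cis_neq1; first by rewrite divr_gt0 // mulr_gt0 // pi_gt0.
by rewrite ler_pdivrMr // mulrC ler_pM2l ?pi_gt0 // ler_nat.
Qed.

Lemma bodyE k x : q (l + k * n) x =
  limacon a b p (x + (l%:R * alpha + k%:R * delta)).
Proof.
rewrite /q /choreography; congr limacon; rewrite /delta /alpha natrD natrM.
ring.
Qed.

Lemma body_t k : q (l + k * n) t = limacon a b p (theta + k%:R * delta).
Proof. by rewrite bodyE addrA. Qed.

Lemma body_velocity k : derive1 (q (l + k * n)) t =
  limacon_velocity a b p (theta + k%:R * delta).
Proof. by rewrite (funext (bodyE k)) derive1_limacon_shift addrA. Qed.

(** Common form of the sums of squared lengths, cross products and squared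
    speeds. *)
Lemma sum_relative_harmonic (A B : R) (F : R -> R) :
    (forall s, F s = A + B * cos ((p - 1)%:~R * s)) ->
    cis ((p - 1)%:~R * delta) != 1 ->
  \sum_(k < m) F (theta + k%:R * delta) = m%:R * A.
Proof.
move=> FE d1; under eq_bigr do rewrite FE mulrDr mulrCA.
rewrite big_split /= sumr_const card_ord -[A *+ m]mulr_natl -mulr_sumr.
by rewrite sum_cos_eq0 ?cis_int_delta_expm // mulr0 addr0.
Qed.

(** The first harmonic of the limaçon sums to zero, and only the second one is
    left. *)
Lemma plane_to_C_g : plane_to_C (g_sub m n q l t) =
  b%:C * \sum_(k < m) cis (p%:~R * theta + k%:R * (p%:~R * delta)).
Proof.
rewrite plane_to_C_sum.
under eq_bigr do rewrite body_t plane_to_C_limacon.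
rewrite big_split /= -!mulr_sumr sum_cis_eq0 ?cis_delta_neq1 //; last first.
  by have := cis_int_delta_expm 1; rewrite mul1r.
rewrite mulr0 add0r; congr (_ * _); apply: eq_bigr => k _.
by rewrite mulrDr mulrCA.
Qed.

Lemma g_sub_eq0 : cis (p%:~R * delta) != 1 -> g_sub m n q l t = 0.
Proof.
move=> d1; apply: plane_to_C_inj; rewrite plane_to_C_g.
by rewrite sum_cis_eq0 ?cis_int_delta_expm // mulr0.
Qed.

Lemma g_sub_const : cis (p%:~R * delta) = 1 ->
  plane_to_C (g_sub m n q l t) = (b * m%:R)%:C * cis (p%:~R * theta).
Proof.
move=> d1; rewrite plane_to_C_g sum_cis_const // mulrA.
by rewrite rmorphM rmorph_nat.
Qed.

Lemma sqr_enorm_g_sub : cis (p%:~R * delta) = 1 ->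
  enorm (g_sub m n q l t) ^+ 2 = (b * m%:R) ^+ 2.
Proof.
move=> /g_sub_const; set s := _ * theta => gE.
have -> : g_sub m n q l t = (b * m%:R * cos s, b * m%:R * sin s).
  apply: plane_to_C_inj; rewrite gE.
  by apply/eqP; rewrite eq_complex /= !mul0r subr0 addr0 !eqxx.
by rewrite sqr_enorm /= !exprMn -mulrDr cos2Dsin2 mulr1.
Qed.

Lemma cis_theta : cis (p%:~R * theta) =
  cexp ('i * p%:~R * t%:C) * cis alpha ^ (l%:Z * p).
Proof.
rewrite /theta mulrDr cisD -cisMz intrM; congr (_ * cis _); last first.
  by rewrite mulrCA mulrA.
rewrite -cexp_imaginary -[_%:C]/(real_complex R _) (rmorphM (real_complex R)).
by rewrite rmorph_int [X in cexp X = _]mulrC mulrA.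
Qed.

Lemma I_subE : cis ((p - 1)%:~R * delta) != 1 ->
  I_sub m n q l t = m%:R * (a ^+ 2 + b ^+ 2).
Proof.
rewrite /I_sub; under eq_bigr do rewrite body_t.
exact: (sum_relative_harmonic (sqr_enorm_limacon a b p)).
Qed.

Lemma c_subE : cis ((p - 1)%:~R * delta) != 1 ->
  c_sub m n q l t = m%:R * (a ^+ 2 + p%:~R * b ^+ 2).
Proof.
rewrite /c_sub; under eq_bigr do rewrite body_t body_velocity.
exact: (sum_relative_harmonic (cross_limacon_velocity a b p)).
Qed.

Lemma K_subE : cis ((p - 1)%:~R * delta) != 1 ->
  K_sub m n q l t = 2^-1 * m%:R * (a ^+ 2 + p%:~R ^+ 2 * b ^+ 2).
Proof.
move=> d1; rewrite /K_sub -mulrA; congr (_ * _).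
under eq_bigr do rewrite body_velocity.
exact: (sum_relative_harmonic (sqr_enorm_limacon_velocity a b p) d1).
Qed.

End RegularSubfamily.

Theorem mainTheorem5 (R : realType) (N m n : nat) (p : int) (a b : R) :
  (4 <= N)%N -> ~~ prime N -> N = (m * n)%N -> (2 <= m)%N -> (2 <= n)%N ->
  p != 0 -> p != 1 -> p != -1 ->
  p%:~R / N%:R \isn't a @Num.int R ->
  (p + 1)%:~R / N%:R \isn't a @Num.int R ->
  (p - 1)%:~R / N%:R \isn't a @Num.int R ->
  a * b != 0 ->
  let omega : R[i] := cexp (2 * (pi : R)%:C * 'i / N%:R) in
  let q := choreography N (limacon a b p) in
  forall (t : R) (l : nat), (l < n)%N ->
  let g := g_sub m n q l t in
  let I := I_sub m n q l t in
  let c := c_sub m n q l t in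
  let K := K_sub m n q l t in
  let tI := Itilde_sub m n q l t in
  [/\ (omega ^ (p * n%:Z) != 1 -> g = 0) /\
      (omega ^ (p * n%:Z) = 1 ->
         plane_to_C g =
           b%:C * m%:R * cexp ('i * p%:~R * t%:C) * omega ^ (l%:Z * p) /\
         enorm g ^+ 2 = (b * m%:R) ^+ 2),
      omega ^ ((p - 1) * n%:Z) != 1 ->
        [/\ I = m%:R * (a ^+ 2 + b ^+ 2),
            c = m%:R * (a ^+ 2 + p%:~R * b ^+ 2) &
            K = 2^-1 * m%:R * (a ^+ 2 + p%:~R ^+ 2 * b ^+ 2)] &
      omega ^ ((p - 1) * n%:Z) != 1 ->
        [/\ tI = m%:R * I - enorm g ^+ 2,
            omega ^ (n%:Z * p) != 1 -> tI = m%:R ^+ 2 * (a ^+ 2 + b ^+ 2) &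
            omega ^ (n%:Z * p) = 1 -> tI = m%:R ^+ 2 * a ^+ 2]].
Proof.
move=> _ _ -> m_gt1 /ltnW n_gt0 _ _ _ _ _ _ _ omega q t l _ g I c K tI.
rewrite /omega omegaE (mulrC n%:Z) -!omega_exp.
have tIE : tI = m%:R * I - enorm g ^+ 2.
  exact: (sum_sqr_enorm_dist m (fun k => q (l + k * n)%N t)).
split.
- split=> [|d1]; first exact: g_sub_eq0.
  split; last exact: sqr_enorm_g_sub.
  by rewrite g_sub_const // cis_theta rmorphM rmorph_nat mulrA.
- by move=> d1; split; [exact: I_subE | exact: c_subE | exact: K_subE].
- move=> d1; have IE : I = m%:R * (a ^+ 2 + b ^+ 2) by exact: I_subE.
  split=> // dp; rewrite tIE IE.
    by rewrite /g g_sub_eq0 // sqr_enorm /= !expr0n addr0 subr0 mulrA.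
  by rewrite /g sqr_enorm_g_sub //; ring.
Qed.
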